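(* For every rational number $m$, define $$\begin{aligned} x_1&=(4m+3)(8m-3), & x_2&=-2(2m+3)(12m-1),\\ x_3&=-4(3m+1)(4m-9), & x_4&=6(4m+1)(8m+1),\\ x_5&=3(4m+1)(16m-3), & x_6&=8(4m+3)(m-1),\\ x_7&=-4(16m+9)(2m-1), & y_1&=(8m+1)(4m-9),\\ y_2&=(16m+9)(12m-1), & y_3&=4(2m+3)(4m+3),\\ y_4&=8(3m+1)(8m-3), & y_5&=-6(4m+1)(2m-1),\\ y_6&=-2(4m+1)(16m-3), & y_7&=-12(4m+3)(m-1). \end{aligned}$$ Then $$\sum_{i=1}^7x_i^r=\sum_{i=1}^7y_i^r\quad\text{for } r=1,2,3,4,5,\qquad\text{and}\qquad \prod_{i=1}^7x_i=\prod_{i=1}^7y_i.$$ Moreover, as a parametric solution this is nontrivial: in $\mathbb{Q}[m]$ the multisets $\{x_1,\dots,x_7\}$ and $\{y_1,\dots,y_7\}$ are distinct. *)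

(* Defs.v *)
From HB Require Import structures.
From mathcomp Require Import all_boot all_order all_algebra.
Set Implicit Arguments.
Unset Strict Implicit.
Unset Printing Implicit Defensive.
Import Order.TTheory GRing.Theory Num.Theory.
Local Open Scope ring_scope.

(* The expressions x_1, ..., x_7 and y_1, ..., y_7 are defined over an arbitrary
   commutative ring, so that the same formulas can be read both as numbers
   (m : rat) and as elements of Q[m] (with m := 'X : {poly rat}).
   Indices are shifted: x_i is tnth (xs m) (i - 1). *)
Definition xs (R : comNzRingType) (m : R) : 7.-tuple R :=
  [tuple (4 * m + 3) * (8 * m - 3);
         - 2 * (2 * m + 3) * (12 * m - 1);
         - 4 * (3 * m + 1) * (4 * m - 9);
         6 * (4 * m + 1) * (8 * m + 1);
         3 * (4 * m + 1) * (16 * m - 3);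
         8 * (4 * m + 3) * (m - 1);
         - 4 * (16 * m + 9) * (2 * m - 1)].

Definition ys (R : comNzRingType) (m : R) : 7.-tuple R :=
  [tuple (8 * m + 1) * (4 * m - 9);
         (16 * m + 9) * (12 * m - 1);
         4 * (2 * m + 3) * (4 * m + 3);
         8 * (3 * m + 1) * (8 * m - 3);
         - 6 * (4 * m + 1) * (2 * m - 1);
         - 2 * (4 * m + 1) * (16 * m - 3);
         - 12 * (4 * m + 3) * (m - 1)].

(* Main.v *)
Require Import Defs.
From HB Require Import structures.
From mathcomp Require Import all_boot all_order all_algebra.
From mathcomp Require Import ring.
Set Implicit Arguments.
Unset Strict Implicit.
Unset Printing Implicit Defensive.
Import Order.TTheory GRing.Theory Num.Theory.
Local Open Scope ring_scope.

(** The equalities are identities between integer polynomials in [m], so they hold in every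
    commutative ring and follow by expansion. For nontriviality, evaluating at 1 would carry a
    permutation in Q[m] to one between rational values, which [xs_ys_1_not_perm] excludes. *)

Lemma power_sums_xs_ys (R : comNzRingType) (m : R) (r : nat) :
  (1 <= r <= 5)%N ->
  \sum_(i < 7) tnth (xs m) i ^+ r = \sum_(i < 7) tnth (ys m) i ^+ r.
Proof.
move: r => [|[|[|[|[|[|r]]]]]] // _;
  rewrite !big_ord_recl !big_ord0 /= !(tnth_nth 0) /=; ring.
Qed.

(** Both sides have the same fourteen linear factors and the same constant, -4608. *)
Lemma prod_xs_ys (R : comNzRingType) (m : R) :
  \prod_(i < 7) tnth (xs m) i = \prod_(i < 7) tnth (ys m) i.
Proof. rewrite !big_ord_recl !big_ord0 /= !(tnth_nth 0) /=; ring. Qed.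

(** The entries are built from [m] and integers by ring operations, so they can be specialised along
    any morphism. *)
Lemma map_xs (R S : comNzRingType) (f : {rmorphism R -> S}) (m : R) :
  map f (xs m) = xs (f m).
Proof. by rewrite /= !(rmorphM, rmorphD, rmorphN, rmorph_nat, rmorph1). Qed.

Lemma map_ys (R S : comNzRingType) (f : {rmorphism R -> S}) (m : R) :
  map f (ys m) = ys (f m).
Proof. by rewrite /= !(rmorphM, rmorphD, rmorphN, rmorph_nat, rmorph1). Qed.

(* At m = 1 the value x_1 = 35 is not among the y_j. *)
Lemma xs_ys_1_not_perm : ~~ perm_eq (xs (1 : rat)) (ys (1 : rat)).
Proof. by vm_compute. Qed.

Theorem mainTheorem8 :
  (forall m : rat,
      (forall r : nat, (1 <= r <= 5)%N ->
         \sum_(i < 7) tnth (xs m) i ^+ r = \sum_(i < 7) tnth (ys m) i ^+ r)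
      /\ \prod_(i < 7) tnth (xs m) i = \prod_(i < 7) tnth (ys m) i)
  /\ ~~ perm_eq (xs ('X : {poly rat})) (ys ('X : {poly rat})).
Proof.
split=> [m|]; first by split=> [r|]; [exact: power_sums_xs_ys | exact: prod_xs_ys].
(* Evaluation at 1 is a ring morphism sending ['X] to the point where the multisets differ. *)
pose f : {rmorphism {poly rat} -> rat} := horner_eval 1.
have fX : f 'X = 1 by exact: hornerX.
by apply: contra xs_ys_1_not_perm => /(perm_map f); rewrite map_xs map_ys fX.
Qed.
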